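(* Let $p \in \mathbb{N}$, let $\mathbf{X} = (X_1,\dots,X_p)$ be an $\mathbb{R}^p$-valued random vector and let $Y$ be a non-degenerate real-valued random variable on a common probability space. Let $(Y,Y')$ be the Markov product of $(\mathbf{X},Y)$, i.e. $Y'$ is a conditionally independent copy of $Y$ given $\mathbf{X}$. Then the following statements are equivalent: (a) $\xi(Y|\mathbf{X}) = 0$. (b) $\mathbf{X}$ and $Y$ are independent. (c) $Y$ and $Y'$ are independent.
   Context: Markov product: $Y'$ is a random variable such that, for $\mathbb{P}^{\mathbf{X}}$-almost all $\mathbf{x} \in \mathbb{R}^p$, the conditional distribution of $Y'$ given $\mathbf{X}=\mathbf{x}$ equals the conditional distribution of $Y$ given $\mathbf{X}=\mathbf{x}$, and $Y$ and $Y'$ are conditionally independent given $\mathbf{X}$. The pair $(Y,Y')$ is called the Markov product of $(\mathbf{X},Y)$. Azadkia and Chatterjee's coefficient: for $Y$ non-degenerate (i.e. not almost surely constant), $$\xi(Y|\mathbf{X}) := \frac{\int_{\mathbb{R}} \operatorname{Var}(\mathbb{P}(Y \geq y \mid \mathbf{X})) \, d\mathbb{P}^Y(y)}{\int_{\mathbb{R}} \operatorname{Var}(\mathbf{1}_{\{Y \geq y\}}) \, d\mathbb{P}^Y(y)}.$$ Here $\mathbb{P}^Z$ denotes the distribution of a random variable or vector $Z$. *)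

(* Defs.v *)
From HB Require Import structures.
From mathcomp Require Import all_boot all_order all_algebra.
From mathcomp Require Import all_classical all_reals all_analysis.

Set Implicit Arguments.
Unset Strict Implicit.
Unset Printing Implicit Defensive.

Import Order.TTheory GRing.Theory Num.Theory.

Local Open Scope classical_set_scope.
Local Open Scope ring_scope.
Local Open Scope ereal_scope.

Section conditional_probability.
Context (d d' : measure_display) (T : measurableType d) (U : measurableType d')
  (R : realType) (P : probability T R).
Implicit Types (X : {RV P >-> U}) (E : set T) (f : U -> R).

(* f is a version of x |-> P(E | X = x) *)
Definition is_cond_prob X E f : Prop :=
  (distribution P X).-integrable [set: U] (EFin \o f) /\
  forall A : set U, measurable A ->
    P (E `&` X @^-1` A) = \int[distribution P X]_(x in A) (f x)%:E.

(* Some version of x |-> P(E | X = x); P(E | X) is cond_prob X E \o X. When E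
   is measurable, a version exists and is unique up to P^X-null sets
   (cond_probP and is_cond_prob_ae_eq below). *)
Definition cond_prob X E : U -> R := xget (cst 0%R) [set f | is_cond_prob X E f].

Lemma is_cond_prob_exists X E : measurable E -> exists f, is_cond_prob X E f.
Proof.
move=> mE.
have mX : measurable_fun [set: T] X by exact: measurable_funPT.
pose nu := measure_function_pushforward__canonical__charge_Charge
  (charge_of_finite_measure (mrestr P mE)) mX.
have nuP : nu `<< distribution P X.
  apply/null_content_dominatesP => A mA PA0.
  rewrite /= /pushforward /charge_of_finite_measure /mrestr.
  apply/eqP; rewrite eq_le measure_ge0 andbT -PA0 /distribution /pushforward.
  by rewrite le_measure// inE//; [apply: measurableI => //|];
    exact: measurable_funPTI.
have finE x : (fine (Radon_Nikodym nu (distribution P X) x))%:E =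
              Radon_Nikodym nu (distribution P X) x.
  by rewrite fineK//; exact: Radon_Nikodym_fin_num.
exists (fine \o Radon_Nikodym nu (distribution P X)); split.
  rewrite (_ : _ \o _ = Radon_Nikodym nu (distribution P X)).
    exact: Radon_Nikodym_integrable.
  by apply/funext => x /=; exact: finE.
move=> A mA; under eq_integral do rewrite finE.
by rewrite -Radon_Nikodym_integral// setIC.
Qed.

Lemma cond_probP X E : measurable E -> is_cond_prob X E (cond_prob X E).
Proof.
by move=> /(is_cond_prob_exists X)[f Xf]; apply: xgetPex; exists f.
Qed.

Lemma is_cond_prob_ae_eq X E f g : is_cond_prob X E f -> is_cond_prob X E g ->
  {ae distribution P X, forall x, f x = g x}.
Proof.
move=> [fi fE] [gi gE].
have : ae_eq (distribution P X) [set: U] (EFin \o f) (EFin \o g).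
  apply: integral_ae_eq => //; first exact: measurable_int gi.
  by move=> A _ mA; rewrite -fE// -gE.
by apply: filterS => x /(_ I) [].
Qed.

End conditional_probability.

Section markov_product.
Context (d d' d'' : measure_display) (T : measurableType d)
  (U : measurableType d') (V : measurableType d'') (R : realType)
  (P : probability T R).
Implicit Types (X : {RV P >-> U}) (Y Z : {RV P >-> V}) (k : R.-pker U ~> V).

(* k is a regular conditional distribution of Y given X *)
Definition is_cond_distribution X Y k : Prop :=
  forall B : set V, measurable B ->
    is_cond_prob X (Y @^-1` B) (fun x => fine (k x B)).

Definition same_cond_distribution X Y Z : Prop :=
  exists k k', [/\ is_cond_distribution X Y k, is_cond_distribution X Z k' &
    {ae distribution P X, forall x,
      forall B : set V, measurable B -> k x B = k' x B}].

Definition cond_independent X Y Z : Prop :=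
  forall A B : set V, measurable A -> measurable B ->
    {ae distribution P X, forall x,
      cond_prob X (Y @^-1` A `&` Z @^-1` B) x =
      (cond_prob X (Y @^-1` A) x * cond_prob X (Z @^-1` B) x)%R}.

(* (Y, Y') is the Markov product of (X, Y) *)
Definition is_markov_product X Y (Y' : {RV P >-> V}) : Prop :=
  same_cond_distribution X Y Y' /\ cond_independent X Y Y'.

End markov_product.

Definition independent_RVs (d d' d'' : measure_display) (T : measurableType d)
    (U : measurableType d') (V : measurableType d'') (R : realType)
    (P : probability T R) (X : {RV P >-> U}) (Y : {RV P >-> V}) : Prop :=
  forall (A : set U) (B : set V), measurable A -> measurable B ->
    P (X @^-1` A `&` Y @^-1` B) = P (X @^-1` A) * P (Y @^-1` B).

Definition non_degenerate (d : measure_display) (T : measurableType d)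
    (R : realType) (P : probability T R) (Y : {RV P >-> R}) : Prop :=
  ~ exists c : R, {ae P, forall w, Y w = c}.

Section azadkia_chatterjee.
Context (d d' : measure_display) (T : measurableType d) (U : measurableType d')
  (R : realType) (P : probability T R).

(* The denominator is positive and finite when Y is non-degenerate. *)
Definition xi (Y : {RV P >-> R}) (X : {RV P >-> U}) : \bar R :=
  (\int[distribution P Y]_y 'V_P[cond_prob X [set w | (y <= Y w)%R] \o X]) /
  (\int[distribution P Y]_y 'V_P[\1_[set w | (y <= Y w)%R]]).

End azadkia_chatterjee.

(* Main.v *)
Require Import Defs.
From mathcomp Require Import all_boot all_order all_algebra.
From mathcomp Require Import all_classical all_reals all_analysis.
From mathcomp Require Import measurable_realfun.

(** The Markov product provides a regular conditional distribution [k] of [Y]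
    given [X] that also serves [Y'], so [P(Y \in B | X)] and [P(Y' \in B | X)]
    have the common version [f_B := k (X, B)], a random variable with values
    in the unit interval that grows with [B]. Everything is driven by one
    equivalence ([event_independentP], [event_independent_variance]): an event is
    independent of [X] iff its conditional probability given [X] is almost
    surely constant, i.e. iff that conditional probability has variance zero.

    - (b) <-> (c). Conditional independence gives
      [P(Y \in A, Y' \in B) = E(f_A f_B)]. If [X] and [Y] are independent, both
      factors are constants and the right-hand side is a product
      ([independent_markov_product]). Conversely, taking [A = B], independence
      of [Y] and [Y'] reads [E(f_B ^ 2) = (E f_B) ^ 2], i.e. [f_B] has variance
      zero ([independent_of_independent_copy]).

    - (a) <-> (b). The denominator of [xi] is at most 1, so [xi = 0] says that
      the numerator vanishes. If [X] and [Y] are independent, the integrand of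
      the numerator is zero. Conversely, the integrand is nonnegative and is
      measurable in [y], being a difference of two monotone functions; hence
      it vanishes for almost every [y] under the law of [Y], and for those [y]
      the event [Y >= y] is independent of [X]. For fixed [A], the finite
      measures [P(X \in A, Y \in -)] and [P(X \in A) P(Y \in -)] thus agree on
      the ray from [y] to +oo for almost all [y]; both are absolutely continuous
      with respect to the law of [Y], which is enough for them to be equal
      ([eq_measure_ae_rays]). *)

Set Implicit Arguments.
Unset Strict Implicit.
Unset Printing Implicit Defensive.

Import Order.TTheory GRing.Theory Num.Theory.

Local Open Scope classical_set_scope.
Local Open Scope ring_scope.
Local Open Scope ereal_scope.

(** * Variance of random variables *)

Section variance_facts.
Context d (T : measurableType d) (R : realType) (P : probability T R).
Implicit Types Z W : T -> R.

Lemma Lfun2_unit_interval Z : measurable_fun [set: T] Z ->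
  (forall w, 0 <= Z w <= 1)%R -> Z \in Lfun P 2%:E.
Proof.
move=> mZ Z01; rewrite inE; apply/andP; split; rewrite inE//=.
rewrite /finite_norm unlock poweR_lty//.
apply: (@le_lt_trans _ _ (\int[P]_x cst 1 x)); last first.
  by rewrite integral_cst//= probability_setT mule1 ltry.
apply: ge0_le_integral => //.
- by move=> x _; rewrite lee_fin powR_ge0.
- apply/measurable_EFinP; apply: (measurableT_comp (measurable_powR _)) => //.
  exact: measurableT_comp.
- move=> x _; have /andP[Z0 Z1] := Z01 x.
  by rewrite /= lee_fin ger0_norm// powR_mulrn// expr_le1.
Qed.

Lemma eq_ae_variance Z W : measurable_fun [set: T] Z ->
  measurable_fun [set: T] W -> {ae P, forall w, Z w = W w} ->
  'V_P[Z] = 'V_P[W].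
Proof.
move=> mZ mW ZW; rewrite /variance unlock.
have -> : 'E_P[Z] = 'E_P[W].
  rewrite unlock; apply: ae_eq_integral => //; try exact/measurable_EFinP.
  by apply: filterS ZW => w /= ->.
rewrite unlock; apply: ae_eq_integral => //.
- by apply/measurable_EFinP/measurable_funM; apply: measurable_funB.
- by apply/measurable_EFinP/measurable_funM; apply: measurable_funB.
- by apply: filterS ZW => w /= ZWw _; rewrite !fctE/= ZWw.
Qed.

Lemma variance_eq0_ae_cst Z : measurable_fun [set: T] Z ->
  'V_P[Z] = 0 -> {ae P, forall w, Z w = fine 'E_P[Z]}.
Proof.
move=> mZ; rewrite /variance unlock; set c := fine _; rewrite unlock => V0.
have : \int[P]_w `|((Z \- cst c) * (Z \- cst c))%R w|%:E = 0.
  by rewrite -[RHS]V0; apply: eq_integral => w _; rewrite ger0_norm// sqr_ge0.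
have mV : measurable_fun setT (EFin \o ((Z \- cst c) * (Z \- cst c))%R).
  by apply/measurable_EFinP/measurable_funM; apply: measurable_funB.
move/(ae_eq_integral_abs P measurableT mV).
apply: filterS => w /(_ I) [] /eqP.
by rewrite !fctE -expr2 sqrf_eq0 subr_eq0 => /eqP.
Qed.

(** The second moment and the squared mean of [Z y] are both nonincreasing in
    [y], hence Borel, and the variance is their difference. *)
Lemma measurable_variance_nonincreasing (Z : R -> T -> R) :
  (forall y, measurable_fun [set: T] (Z y)) ->
  (forall y w, 0 <= Z y w <= 1)%R ->
  (forall w, nonincreasing_fun (Z^~ w)) ->
  measurable_fun [set: R] (fun y => 'V_P[Z y]).
Proof.
move=> mZ Z01 Znd.
have E1 y : 'E_P[Z y] \is a fin_num.
  rewrite expectation_fin_num// Lfun_subset12 ?fin_num_measure//.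
  exact: Lfun2_unit_interval.
have E2 y : 'E_P[Z y ^+ 2] \is a fin_num.
  have Z2 := Lfun2_unit_interval (mZ y) (Z01 y).
  by rewrite expectation_fin_num// Lfun2_mul_Lfun1.
have -> : (fun y => 'V_P[Z y]) =
    EFin \o (fun y => fine 'E_P[Z y ^+ 2] - fine 'E_P[Z y] ^+ 2)%R.
  apply/funext => y /=; rewrite varianceE; last exact: Lfun2_unit_interval.
  by rewrite EFinB EFin_expe !fineK.
apply/measurable_EFinP; apply: measurable_funB; last apply: measurable_funX.
- apply: nonincreasing_measurable => // y z yz; apply: fine_le => //.
  rewrite unlock; apply: ge0_le_integral => //.
  + by move=> w _; rewrite lee_fin sqr_ge0.
  + by apply/measurable_EFinP; exact: (measurable_funM (f := Z _) (g := Z _)).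
  + by apply/measurable_EFinP; exact: (measurable_funM (f := Z _) (g := Z _)).
  + move=> w _; rewrite lee_fin; have /andP[? ?] := Z01 z w.
    have /andP[? ?] := Z01 y w.
    by rewrite ler_pM// Znd.
- apply: nonincreasing_measurable => // y z yz; apply: fine_le => //.
  rewrite unlock; apply: ge0_le_integral => //.
  + by move=> w _; rewrite lee_fin; have /andP[] := Z01 z w.
  + exact/measurable_EFinP.
  + exact/measurable_EFinP.
  + by move=> w _; rewrite lee_fin Znd.
Qed.

Lemma variance_le1 Z : measurable_fun [set: T] Z ->
  (forall w, 0 <= Z w <= 1)%R -> 'V_P[Z] <= 1.
Proof.
move=> mZ Z01; rewrite varianceE; last exact: Lfun2_unit_interval.
have EZ : 'E_P[Z] \is a fin_num.
  rewrite expectation_fin_num// Lfun_subset12 ?fin_num_measure//.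
  exact: Lfun2_unit_interval.
apply: (@le_trans _ _ 'E_P[Z ^+ 2]).
  by rewrite -[leRHS]sube0 leeB// -(fineK EZ) -EFin_expe lee_fin sqr_ge0.
rewrite -(expectation_cst P 1) unlock; apply: ge0_le_integral => //.
- by move=> w _; rewrite lee_fin sqr_ge0.
- by apply/measurable_EFinP; exact: (measurable_funM mZ mZ).
- exact/measurable_EFinP.
- move=> w _; have /andP[Z0 Z1] := Z01 w.
  by rewrite lee_fin; apply: mulr_ile1.
Qed.

End variance_facts.

(** * Measures that agree on almost all rays *)

Section ae_rays.
Context (R : realType).
Variables m1 m2 mu : {measure set R -> \bar R}.

(** Given [y], let [a] be the infimum of the points z >= y for which the two
    measures agree on the closed ray from z. If there is no such point, the
    whole ray from [y] is null for [mu], hence for [m1] and [m2]. Otherwise the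
    points between [y] and [a] form a null set, so the ray may be taken to start
    at [a]. Either the measures agree there, or the point [a] is itself null
    and is approached from above by points of agreement; agreement on the open
    ray from [a] then follows by continuity from below. Closed rays form a
    pi-system that generates the Borel sets, which gives the conclusion. *)
Lemma eq_measure_ae_rays : m1 [set: R] < +oo -> m1 `<< mu -> m2 `<< mu ->
  {ae mu, forall y, m1 `[y, +oo[%classic = m2 `[y, +oo[%classic} ->
  forall B : set R, measurable B -> m1 B = m2 B.
Proof.
move=> m1oo m1mu m2mu.
pose good := [set y | m1 `[y, +oo[%classic = m2 `[y, +oo[%classic].
move=> [N [mN muN0 badN]].
have null (m : {measure set R -> \bar R}) (A : set R) : m `<< mu ->
    measurable A -> A `<=` N -> m A = 0.
  by move=> mmu mA AN; apply: (mmu N) => //; exact/measure0_null_setP.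
have nullU (m : {measure set R -> \bar R}) (A B : set R) : m `<< mu ->
    measurable A -> measurable B -> A `<=` N -> m (A `|` B) = m B.
  move=> mmu mA mB AN; rewrite setUC.
  have h : m.-null_set A by apply/measure0_null_setP => //; exact: null.
  exact: (null_setU m mA).1 h B mB.
have ray y : m1 `[y, +oo[%classic = m2 `[y, +oo[%classic.
  pose D := [set z | y <= z /\ good z]%R.
  have nDN z : (y <= z)%R -> ~ D z -> N z.
    by move=> yz nDz; apply: badN => /= gz; apply: nDz; split.
  have [D0|D0] := eqVneq D set0.
    have yN : `[y, +oo[%classic `<=` N.
      move=> z /=; rewrite in_itv/= andbT => yz; apply: nDN => //.
      by rewrite D0.
    by rewrite !null.
  have Dlb : has_lbound D by exists y => z [].
  have {}D0 : D !=set0 by exact/set0P.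
  pose a := inf D.
  have ya : (y <= a)%R by apply: lb_le_inf => // z [].
  have lt_aN z : (y <= z)%R -> (z < a)%R -> N z.
    move=> yz za; apply: nDN => // Dz; move: za; rewrite ltNge => /negP; apply.
    exact: ge_inf.
  have yaN : `[y, a[%classic `<=` N.
    by move=> z /=; rewrite in_itv/= => /andP[]; exact: lt_aN.
  have split_a (m : {measure set R -> \bar R}) : m `<< mu ->
      m `[y, +oo[%classic = m `[a, +oo[%classic.
    move=> mmu; rewrite (@itv_bndbnd_setU _ _ _ (BLeft a)) ?bnd_simp//.
    exact: nullU.
  rewrite !split_a//.
  have [[_ //]|nDa] := pselect (D a).
  have aN : [set a] `<=` N by move=> _ ->; exact: nDN.
  have open_a (m : {measure set R -> \bar R}) : m `<< mu ->
      m `[a, +oo[%classic = m `]a, +oo[%classic.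
    by move=> mmu; rewrite -(@setU1itv _ _ _ _ false) ?bnd_simp//; exact: nullU.
  rewrite !open_a//.
  have near_a n : exists g, [/\ D g, a < g & g < a + n.+1%:R^-1]%R.
    have [//|g Dg ga] := @inf_adherent _ D n.+1%:R^-1 _ (conj D0 Dlb).
    exists g; split => //; rewrite lt_neqAle ge_inf// andbT.
    by apply/eqP => ag; apply: nDa; rewrite ag.
  have /choice[g gP] := near_a.
  (* The points [g n] need not decrease, so the closed ray from [g n] is
     squeezed between the closed ray from a + 1/(n+1), which does grow with n,
     and the open ray from [a]. *)
  have cvg_g (m : {measure set R -> \bar R}) :
      m `[g n, +oo[%classic @[n --> \oo] --> m `]a, +oo[%classic.
    pose F n : set R := `[(a + n.+1%:R^-1)%R, +oo[%classic.
    have mF n : measurable (F n) by exact: measurable_itv.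
    apply: (@squeeze_cvge _ _ _ _ (m \o F) _ (cst (m `]a, +oo[%classic))).
    - near=> n; have [_ ag gn] := gP n; apply/andP; split.
        rewrite /= le_measure ?inE// /F.
        by apply: subset_itvr; rewrite bnd_simp ltW.
      by rewrite le_measure ?inE//; apply: subset_itvr; rewrite bnd_simp.
    - rewrite itvoyEbigcup; apply: nondecreasing_cvg_mu => //.
        exact: bigcupT_measurable.
      move=> i j ij; apply/subsetPset/subset_itvr; rewrite bnd_simp lerD2l.
      by rewrite lef_pV2 ?posrE// ler_nat.
    - exact: cvg_cst.
  apply: (cvg_unique _ (cvg_g m1)) => //.
  rewrite (_ : (fun n => m1 `[g n, +oo[%classic) =
               (fun n => m2 `[g n, +oo[%classic)); first exact: cvg_g.
  by apply/funext => n; have [[]] := gP n.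
move=> B mB.
apply: (measure_unique (@RGenCInfty.G R)
  (fun n => `[(- n%:R)%R, +oo[%classic)) => //.
- exact: RGenCInfty.measurableE.
- move=> _ _ [x ->] [y ->]; exists (Num.max x y).
  apply/seteqP; split=> z /=; rewrite !in_itv/= !andbT ge_max.
    by move=> [-> ->].
  by move=> /andP[].
- by move=> n; exists (- n%:R)%R.
- apply/seteqP; split => // x _; exists (Num.bound `|x|) => //=.
  rewrite in_itv/= andbT lerNl (le_trans (ler_norm _))// normrN ltW//.
  exact: archi_boundP.
- by move=> A [x ->]; exact: ray.
- by move=> n; rewrite (le_lt_trans _ m1oo)// le_measure ?inE.
Unshelve. all: by end_near. Qed.

End ae_rays.

(** * Conditional probabilities and independence from [X] *)

Section conditional_probability.
Context (d d' : measure_display) (T : measurableType d) (U : measurableType d')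
  (R : realType) (P : probability T R) (X : {RV P >-> U}).
Implicit Types (E : set T) (f g : U -> R).

Definition event_independent E := forall A : set U, measurable A ->
  P (E `&` X @^-1` A) = P E * P (X @^-1` A).

Lemma ae_distribution (Q : U -> Prop) :
  {ae distribution P X, forall x, Q x} -> {ae P, forall w, Q (X w)}.
Proof.
move=> [N [mN N0 QN]]; exists (X @^-1` N); split => //.
- exact: measurable_funPTI.
- by move=> w; exact: QN.
Qed.

(** Measurability of [Q] is what allows an exceptional set in [T] to be
    transported to one in [U]. *)
Lemma ae_distributionV (Q : U -> Prop) : measurable [set x | Q x] ->
  {ae P, forall w, Q (X w)} -> {ae distribution P X, forall x, Q x}.
Proof.
move=> mQ QX; exists (~` [set x | Q x]); split => //.
  exact: measurableC.
have mQX : measurable (X @^-1` (~` [set x | Q x])).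
  exact/measurable_funPTI/measurableC.
exact: (negligibleP P mQX).1 QX.
Qed.

Lemma measurable_cond_prob E f :
  is_cond_prob X E f -> measurable_fun [set: U] f.
Proof. by case=> /measurable_int/measurable_EFinP. Qed.

Lemma is_cond_prob_setT E f : is_cond_prob X E f ->
  P E = \int[distribution P X]_x (f x)%:E.
Proof. by case=> _ /(_ setT measurableT) <-; rewrite preimage_setT setIT. Qed.

Lemma is_cond_prob_ae E f g : is_cond_prob X E f -> measurable_fun [set: U] g ->
  {ae distribution P X, forall x, f x = g x} -> is_cond_prob X E g.
Proof.
move=> [fi fE] mg fg; have mf := measurable_int _ fi; split.
  move/integrableP : fi => [_ foo].
  apply/integrableP; split; first exact/measurable_EFinP.
  rewrite (ae_eq_integral (fun x => `|(f x)%:E|)) => //.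
  - by apply: measurableT_comp => //; exact/measurable_EFinP.
  - exact: measurableT_comp.
  - by apply: filterS fg => x /= ->.
move=> A mA; rewrite fE//; apply: ae_eq_integral => //.
- exact: measurable_funTS.
- by apply: measurable_funTS; exact/measurable_EFinP.
- by apply: filterS fg => x /= ->.
Qed.

(** Independence says that the constant [P E] is a version of [P(E | X)], and
    versions are almost surely unique. *)
Lemma event_independent_ae E f : is_cond_prob X E f ->
  measurable E -> event_independent E ->
  {ae distribution P X, forall x, f x = fine (P E)}.
Proof.
move=> fE mE EX; apply: (is_cond_prob_ae_eq fE); split.
  exact: finite_measure_integrable_cst.
move=> A mA; rewrite EX// integral_cst//= fineK//.
exact: fin_num_measure.
Qed.

(** If a constant [c] is a version of [P(E | X)], integrating it over [U] gives
    [P E = c], so that the defining identity becomes the product rule. *)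
Lemma event_independentP E f : measurable E -> is_cond_prob X E f ->
  event_independent E <->
  exists c : R, {ae distribution P X, forall x, f x = c}.
Proof.
move=> mE fE; split=> [EX|[c fc]].
  by exists (fine (P E)); exact: event_independent_ae.
have cE : is_cond_prob X E (cst c) by exact: is_cond_prob_ae fE _ fc.
have PE : P E = c%:E.
  rewrite (is_cond_prob_setT cE) (integral_cst _ _ c%:E)//=.
  by rewrite probability_setT mule1.
by move=> A mA; rewrite cE.2// (integral_cst _ _ c%:E)// PE.
Qed.

(** The form of the previous equivalence that both [xi] and the second moments
    of the Markov product detect. *)
Lemma event_independent_variance E f : measurable E -> is_cond_prob X E f ->
  event_independent E <-> 'V_P[f \o X] = 0.
Proof.
move=> mE fE; have mf := measurable_cond_prob fE.
have mfX : measurable_fun [set: T] (f \o X) by exact: measurableT_comp.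
split=> [/(event_independentP mE fE)[c fc]|/(variance_eq0_ae_cst mfX) fXc].
  rewrite -(variance_cst P c); apply: eq_ae_variance => //.
  exact: (ae_distribution fc).
apply/(event_independentP mE fE); exists (fine 'E_P[f \o X]).
apply: ae_distributionV => //.
rewrite [X in measurable X](_ : _ = f @^-1` [set fine 'E_P[f \o X]])//.
by rewrite -[X in measurable X]setTI; exact: mf.
Qed.

End conditional_probability.

(** * Independence of the Markov product *)

Section markov.
Context (d d' : measure_display) (T : measurableType d) (U : measurableType d')
  (R : realType) (P : probability T R) (X : {RV P >-> U}).

(** The two kernels of [same_cond_distribution] agree almost everywhere, so the
    first one serves for both variables and can be used throughout as a
    version that takes values in the unit interval and is monotone in the
    event. *)
Lemma markov_product_kernel (d'' : measure_display) (V : measurableType d'')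
    (Y Y' : {RV P >-> V}) : is_markov_product X Y Y' ->
  exists k : R.-pker U ~> V,
    is_cond_distribution X Y k /\ is_cond_distribution X Y' k.
Proof.
move=> [[k [k' [kY kY' kk']]] _]; exists k; split=> // B mB.
apply: (is_cond_prob_ae (kY' B mB)).
  exact: (measurable_cond_prob (kY B mB)).
by apply: filterS kk' => x /(_ B mB) ->.
Qed.

Lemma pker_le1 (d'' : measure_display) (V : measurableType d'')
  (k : R.-pker U ~> V) x (B : set V) : measurable B -> k x B <= 1.
Proof. by move=> mB; rewrite -(prob_kernel (s := k) x) le_measure ?inE. Qed.

Lemma pker_fin_num (d'' : measure_display) (V : measurableType d'')
  (k : R.-pker U ~> V) x (B : set V) : measurable B -> k x B \is a fin_num.
Proof.
by move=> mB; rewrite ge0_fin_numE// (le_lt_trans (pker_le1 _ _ mB))// ltry.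
Qed.

Lemma fine_pker_itv01 (d'' : measure_display) (V : measurableType d'')
  (k : R.-pker U ~> V) x (B : set V) : measurable B ->
  (0 <= fine (k x B) <= 1)%R.
Proof.
by move=> mB; rewrite fine_ge0//= -lee_fin fineK ?pker_le1// pker_fin_num.
Qed.

Lemma independent_RVsP (d'' : measure_display) (V : measurableType d'')
    (Y : {RV P >-> V}) : independent_RVs X Y <->
  forall B, measurable B -> event_independent X (Y @^-1` B).
Proof.
split=> [XY B mB A mA|XY A B mA mB]; first by rewrite setIC XY// muleC.
by rewrite setIC XY// muleC.
Qed.

(** Conditional independence turns [P(Y \in A, Y' \in B | X)] into a product of
    two conditional probabilities, which are constant when [X] and [Y] are
    independent. *)
Lemma independent_markov_product (d'' : measure_display)
    (V : measurableType d'') (Y Y' : {RV P >-> V}) : is_markov_product X Y Y' ->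
  independent_RVs X Y -> independent_RVs Y Y'.
Proof.
move=> YY' /independent_RVsP XY A B mA mB.
have [k [kY kY']] := markov_product_kernel YY'.
have mY C : measurable C -> measurable (Y @^-1` C).
  by move=> mC; exact: measurable_funPTI.
have mY' C : measurable C -> measurable (Y' @^-1` C).
  by move=> mC; exact: measurable_funPTI.
have PY' : P (Y' @^-1` B) = P (Y @^-1` B).
  by rewrite (is_cond_prob_setT (kY B mB)) (is_cond_prob_setT (kY' B mB)).
have kA := event_independent_ae (kY A mA) (mY _ mA) (XY _ mA).
have kB := event_independent_ae (kY B mB) (mY _ mB) (XY _ mB).
have gA := is_cond_prob_ae_eq (cond_probP X (mY _ mA)) (kY A mA).
have gB := is_cond_prob_ae_eq (cond_probP X (mY' _ mB)) (kY' B mB).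
have mAB := measurableI _ _ (mY _ mA) (mY' _ mB).
pose c : R := (fine (P (Y @^-1` A)) * fine (P (Y @^-1` B)))%R.
have cE : is_cond_prob X (Y @^-1` A `&` Y' @^-1` B) (cst c).
  apply: (is_cond_prob_ae (cond_probP X mAB)) => //.
  have fAB := YY'.2 A B mA mB.
  near=> x; rewrite /= (near fAB x)// (near gA x)// (near gB x)//.
  by rewrite (near kA x)// (near kB x).
rewrite (is_cond_prob_setT cE) (integral_cst _ _ c%:E)//= probability_setT.
by rewrite mule1 PY' EFinM !fineK//; apply: fin_num_measure; exact: mY.
Unshelve. all: by end_near. Qed.

(** Only events of the form [Y \in B, Y' \in B] are used: with [f] the common
    conditional probability, [E (f ^ 2) = P(Y \in B, Y' \in B)] and
    [E f = P(Y \in B)], so independence of the copies is [Var f = 0]. *)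
Lemma independent_of_independent_copy (d'' : measure_display)
    (V : measurableType d'') (Y Y' : {RV P >-> V}) : is_markov_product X Y Y' ->
  independent_RVs Y Y' -> independent_RVs X Y.
Proof.
move=> YY' indYY'; apply/independent_RVsP => B mB.
have [k [kY kY']] := markov_product_kernel YY'.
have mY : measurable (Y @^-1` B) by exact: measurable_funPTI.
have mY' : measurable (Y' @^-1` B) by exact: measurable_funPTI.
pose f x := fine (k x B).
have mf : measurable_fun [set: U] f := measurable_cond_prob (kY B mB).
have mfX : measurable_fun [set: T] (f \o X) by exact: measurableT_comp.
have f01 x : (0 <= f x <= 1)%R by exact: fine_pker_itv01.
have f0 x : (0 <= f x)%R by have /andP[] := f01 x.
have EfX : 'E_P[f \o X] = P (Y @^-1` B).
  rewrite (is_cond_prob_setT (kY B mB)) unlock ge0_integral_distribution//.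
  exact/measurable_EFinP.
have EfX2 : 'E_P[(f \o X) ^+ 2] = P (Y @^-1` B `&` Y' @^-1` B).
  have gB := is_cond_prob_ae_eq (cond_probP X mY) (kY B mB).
  have gB' := is_cond_prob_ae_eq (cond_probP X mY') (kY' B mB).
  have mBB := measurableI _ _ mY mY'.
  have ffE : is_cond_prob X (Y @^-1` B `&` Y' @^-1` B) (f \* f)%R.
    apply: (is_cond_prob_ae (cond_probP X mBB)); first exact: measurable_funM.
    have := YY'.2 B B mB mB; move: gB gB'.
    by apply: filterS3 => x /= gx gx' ->; rewrite gx gx'.
  rewrite (is_cond_prob_setT ffE).
  rewrite ge0_integral_distribution//.
  - by rewrite unlock.
  - exact/measurable_EFinP/measurable_funM.
  - by move=> x; rewrite lee_fin mulr_ge0.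
apply/(event_independent_variance mY (kY B mB)).
rewrite varianceE; last by apply: Lfun2_unit_interval => // w; exact: f01.
rewrite EfX2 EfX indYY'//.
have -> : P (Y' @^-1` B) = P (Y @^-1` B).
  by rewrite (is_cond_prob_setT (kY B mB)) (is_cond_prob_setT (kY' B mB)).
by rewrite -expe2 subee// fin_numX// fin_num_measure.
Qed.

End markov.

(** * Vanishing of the coefficient of Azadkia and Chatterjee *)

Section xi.
Context (d d' : measure_display) (T : measurableType d) (U : measurableType d')
  (R : realType) (P : probability T R) (X : {RV P >-> U}) (Y : {RV P >-> R}).

Lemma ge_preimage (y : R) : [set w | (y <= Y w)%R] = Y @^-1` `[y, +oo[.
Proof. by apply/seteqP; split => w /=; rewrite in_itv/= andbT. Qed.

Lemma measurable_ge (y : R) : measurable [set w | (y <= Y w)%R].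
Proof. by rewrite ge_preimage; exact: measurable_funPTI. Qed.

(** In [\bar R] a quotient also vanishes when its denominator is infinite; this
    is excluded because the variance of an indicator is at most 1. *)
Lemma xi_eq0 : xi Y X = 0 <->
  \int[distribution P Y]_y
    'V_P[cond_prob X [set w | (y <= Y w)%R] \o X] = 0.
Proof.
rewrite /xi; set den := \int[_]_y 'V_P[\1__]; split=> [/eqP|->]; last first.
  by rewrite mul0e.
rewrite mule_eq0 => /orP[/eqP//|]; rewrite inve_eq0 => /eqP denoo.
suff : den <= 1 by rewrite denoo.
have mI y : measurable_fun [set: T] (\1_[set w | (y <= Y w)%R] : T -> R).
  by apply: measurable_indic; exact: measurable_ge.
have I01 y w : (0 <= (\1_[set w | (y <= Y w)%R] w : R) <= 1)%R.
  by rewrite indicE; case: (_ \in _); rewrite ?lexx ?ler01.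
apply: (@le_trans _ _ (\int[distribution P Y]_y cst 1 y)); last first.
  by rewrite integral_cst//= probability_setT mule1.
apply: ge0_le_integral => //.
- by move=> y _; exact: variance_ge0.
- apply: measurable_variance_nonincreasing => // w y z yz.
  rewrite !indicE ler_nat; have [/set_mem/= zw|//] := boolP (w \in _).
  by rewrite mem_set//= (le_trans yz).
- by move=> y _; exact: variance_le1.
Qed.

Lemma independent_xi : independent_RVs X Y -> xi Y X = 0.
Proof.
move=> /independent_RVsP XY; apply/xi_eq0.
apply: integral0_eq => y _.
have mE := measurable_ge y.
apply/(event_independent_variance mE (cond_probP X mE)).
by rewrite ge_preimage; exact: XY.
Qed.

(** The versions chosen by [cond_prob] for different [y] are unrelated, so they
    are first replaced by the kernel, which is pointwise monotone in [y]; this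
    makes the variance a measurable function of [y]. *)
Lemma xi_independent (k : R.-pker U ~> R) : is_cond_distribution X Y k ->
  xi Y X = 0 -> independent_RVs X Y.
Proof.
move=> kY /xi_eq0 V0.
pose Z (y : R) : T -> R := (fun x => fine (k x `[y, +oo[%classic)) \o X.
have mI (y : R) : measurable `[y, +oo[%classic by exact: measurable_itv.
have kE y : is_cond_prob X [set w | (y <= Y w)%R]
    (fun x => fine (k x `[y, +oo[%classic)).
  by rewrite ge_preimage; exact: kY.
have mZ y : measurable_fun [set: T] (Z y).
  by apply: measurableT_comp => //; exact: measurable_cond_prob (kE y).
have Z01 y w : (0 <= Z y w <= 1)%R by exact: fine_pker_itv01.
have VZ y : 'V_P[cond_prob X [set w | (y <= Y w)%R] \o X] = 'V_P[Z y].
  have cE := cond_probP X (measurable_ge y).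
  apply: eq_ae_variance => //.
    by apply: measurableT_comp => //; exact: measurable_cond_prob cE.
  exact: (ae_distribution (is_cond_prob_ae_eq cE (kE y))).
have mVZ : measurable_fun [set: R] (fun y => 'V_P[Z y]).
  apply: measurable_variance_nonincreasing => // w y z yz.
  rewrite /Z/= fine_le//.
  - exact: pker_fin_num.
  - exact: pker_fin_num.
  - by rewrite le_measure ?inE//; apply: subset_itvr; rewrite bnd_simp.
have ae0 : {ae distribution P Y, forall y, 'V_P[Z y] = 0}.
  have : \int[distribution P Y]_y `|'V_P[Z y]| = 0.
    rewrite -[RHS]V0; apply: eq_integral => y _.
    by rewrite VZ gee0_abs// variance_ge0.
  move/(ae_eq_integral_abs _ measurableT mVZ).
  by apply: filterS => y /(_ I).
move=> A B mA mB.
have mXA : measurable (X @^-1` A) by exact: measurable_funPTI.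
have mY : measurable_fun [set: T] Y by exact: measurable_funPT.
(* With [A] fixed, [m1] is P(X \in A, Y \in -) and [m2] is the product of
   P(X \in A) with the law of [Y]. *)
pose m1 := measure_function_pushforward__canonical__measure_function_Measure
  (mrestr P mXA) mY.
pose m2 := mscale (NngNum (fine_ge0 (measure_ge0 P (X @^-1` A))))
  (distribution P Y).
have -> : P (X @^-1` A `&` Y @^-1` B) = m1 B by rewrite setIC.
have m2E C : m2 C = P (X @^-1` A) * P (Y @^-1` C).
  by rewrite /m2/= /mscale/= fineK// fin_num_measure.
rewrite -m2E.
apply: (@eq_measure_ae_rays _ m1 m2 (distribution P Y)) => //.
- rewrite /m1/= /pushforward/= /mrestr preimage_setT setTI ltey_eq.
  by rewrite fin_num_measure.
- apply/null_content_dominatesP => C mC PC0; rewrite /m1/= /pushforward /mrestr.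
  apply/eqP; rewrite eq_le measure_ge0 andbT -PC0 le_measure ?inE//.
    by apply: measurableI => //; exact: measurable_funPTI.
  exact: measurable_funPTI.
- apply/null_content_dominatesP => C mC PC0.
  apply: (eq_trans (m2E C)).
  by rewrite -[P _ in X in _ * X]/(distribution P Y C) PC0 mule0.
- apply: filterS ae0 => y Vy0; apply: (eq_trans _ (esym (m2E _))).
  have mE : measurable (Y @^-1` `[y, +oo[) by exact: measurable_funPTI.
  have /(event_independent_variance mE (kY _ (mI y))) := Vy0.
  by move=> /(_ A mA) EA; rewrite muleC -EA.
Qed.

End xi.

Theorem theorem2p1 (d : measure_display) (T : measurableType d) (R : realType)
    (P : probability T R) (p : nat)
    (X : {RV P >-> p.-tuple R}) (Y Y' : {RV P >-> R})
    (hY : non_degenerate Y) (hYY' : is_markov_product X Y Y') :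
  (xi Y X = 0%E <-> independent_RVs X Y) /\
  (independent_RVs X Y <-> independent_RVs Y Y').
Proof.
have [k [kY _]] := markov_product_kernel hYY'.
split; split.
- exact: xi_independent kY.
- exact: independent_xi.
- exact: independent_markov_product.
- exact: independent_of_independent_copy.
Qed.
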